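(* Let $m\ge 1$, let $\pi_k$ ($k\ge 0$) be $m\times m$ matrices with elements from $\overline{K}_c$, let $\varphi_j\in(\overline{K}_c)^m$ ($j\ge 0$), and set $$P(\tau)z=\sum_{k=0}^\infty \pi_k z^{q^k}\quad (z\in(\overline{K}_c)^m),\qquad f(t)=\sum_{j=0}^\infty \varphi_j\frac{t^{q^j}}{D_j}\quad (t\in K),$$ where both series are assumed to have positive radii of convergence. Then for any $y_0\in(\overline{K}_c)^m$ the equation $$dy(t)=P(\tau)y(t)+f(t)$$ has a unique local solution (i.e. a solution in some neighbourhood of $t=0$) of the form $$y(t)=\sum_{i=0}^\infty y_i\frac{t^{q^i}}{D_i},\qquad y_i\in(\overline{K}_c)^m,$$ with the series having a positive radius of convergence, which satisfies the initial condition $$\lim_{t\to 0}t^{-1}y(t)=y_0.$$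
   Context: Let $p$ be a prime, $q=p^{\upsilon}$ with $\upsilon$ a positive integer, and $K=\mathbf F_q((x))$ the field of formal Laurent series in $x$ over the finite field $\mathbf F_q$, with absolute value $|t|=q^{-n}$ for $t=\sum_{i\ge n}\theta_i x^i$, $\theta_i\in\mathbf F_q$, $\theta_n\neq 0$. Let $\overline{K}_c$ be the completion of an algebraic closure of $K$, with the extended absolute value $|\cdot|$. For a vector or matrix, $|\cdot|$ denotes the maximum of the absolute values of its entries. For $i\in\mathbf Z$, $i\ge 1$, put $[i]=x^{q^i}-x\in K$. The Carlitz factorial is $D_0=1$, $D_i=[i][i-1]^q\cdots[1]^{q^{i-1}}$ for $i\ge 1$. The operator $\tau$ is $\tau u=u^q$, acting component-wise on vectors and matrices; thus $z^{q^k}=(z_1^{q^k},\dots,z_m^{q^k})$ for $z=(z_1,\dots,z_m)$. The operator $d$ is defined by $(du)(t)=\bigl(u(xt)-xu(t)\bigr)^{1/q}$ (component-wise on vector-valued functions), where $1/q$ denotes the unique $q$-th root in $\overline{K}_c$. A series $\sum_i c_i t^{q^i}$ has a positive radius of convergence if it converges for all $t$ with $|t|$ smaller than some $R>0$; similarly for $\sum_k\pi_k z^{q^k}$ with $|z|<R$. A function given by a series $\sum y_i t^{q^i}/D_i$ with positive radius of convergence tends to $0$ as $t\to 0$, so the right-hand side $P(\tau)y(t)+f(t)$ makes sense for small $|t|$. *)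

(* Defs.v *)
From HB Require Import structures.
From mathcomp Require Import all_boot all_order all_algebra.
From mathcomp Require Import all_classical all_reals all_analysis.

Set Implicit Arguments.
Unset Strict Implicit.
Unset Printing Implicit Defensive.

Import Order.TTheory GRing.Theory Num.Theory.
Import numFieldNormedType.Exports.

Local Open Scope classical_set_scope.
Local Open Scope ring_scope.

Definition bounded_below (F : fieldType) (f : int -> F) :=
  exists N : int, forall i, i < N -> f i = 0.

(* The series \sum_i (lcoef t i) x^i. *)
Record laurent (F : fieldType) := Laurent {
  lcoef :> int -> F ;
  lcoefP : bounded_below lcoef }.

HB.instance Definition _ (F : fieldType) := gen_eqMixin (laurent F).
HB.instance Definition _ (F : fieldType) := gen_choiceMixin (laurent F).

Section LaurentField.
Variable F : fieldType.
Implicit Types (f g h : laurent F) (a b : int -> F).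

Lemma laurentP f g : (forall i, f i = g i) -> f = g.
Proof.
case: f g => [f Pf] [g Pg] /= fg.
have E : f = g by apply: funext.
by case: _ / E Pg => Pg; congr Laurent; apply: Prop_irrelevance.
Qed.

Lemma laurent0_subproof : bounded_below (fun _ : int => 0 : F).
Proof. by exists 0. Qed.
Definition laurent0 := Laurent laurent0_subproof.

Lemma laurentD_subproof f g : bounded_below (fun i => f i + g i).
Proof.
case: (lcoefP f) (lcoefP g) => [A HA] [B HB].
by exists (Num.min A B) => i; rewrite lt_min => /andP[iA iB]; rewrite HA ?HB ?addr0.
Qed.
Definition laurentD f g := Laurent (laurentD_subproof f g).

Lemma laurentN_subproof f : bounded_below (fun i => - f i).
Proof. by case: (lcoefP f) => A HA; exists A => i iA; rewrite HA ?oppr0. Qed.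
Definition laurentN f := Laurent (laurentN_subproof f).

Lemma laurent_mono_subproof (c : F) (n : int) :
  bounded_below (fun i => if i == n then c else 0).
Proof. by exists n => i; case: eqP => // ->; rewrite ltxx. Qed.
Definition laurent_mono c n := Laurent (laurent_mono_subproof c n).

(* A finite-support sum: finite because Laurent series are bounded below. *)
Definition conv a b (k : int) : F :=
  \sum_(i \in [set: int]) a i * b (k - i).

Lemma int_geP (A i : int) : A <= i -> exists k : nat, i = A + k%:Z.
Proof.
rewrite -subr_ge0 => Ai; exists `|i - A|%N.
by rewrite gez0_abs // [RHS]addrC subrK.
Qed.

Lemma convE a b (A B : int) (k : nat) :
  (forall i, i < A -> a i = 0) -> (forall i, i < B -> b i = 0) ->
  conv a b (A + B + k%:Z) =
    \sum_(j < k.+1) a (A + j%:Z) * b (B + (k - j)%N%:Z).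
Proof.
move=> HA HB.
pose r := [seq A + j%:Z | j <- iota 0 k.+1].
rewrite /conv (fsbigE r) //.
- rewrite big_mkcond /= big_map -[k.+1 in LHS]subn0 -/(index_iota 0 k.+1).
  rewrite big_mkord; apply: eq_bigr => j _; rewrite in_setT; congr (_ * b _).
  rewrite -subzn ?[A + B]addrC -1?ltnS //.
  by rewrite opprD addrA -[_ + A + _ - A]addrAC addrK addrA.
- by rewrite map_inj_uniq ?iota_uniq // => x y /addrI [].
- move=> i _ ir; have [/HA -> | Ai] := ltP i A; first by rewrite mul0r.
  rewrite HB ?mulr0 //.
  have [j ij] := int_geP Ai.
  move: ir; rewrite ij => ir.
  have kj : (k < j)%N.
    rewrite ltnNge; apply: contra ir => jk; apply/mapP; exists j => //.
    by rewrite mem_iota add0n ltnS.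
  by rewrite opprD addrA -[_ + B + _ - A]addrAC [A + B]addrC addrK -addrA
     gtrDl subr_lt0 ltz_nat.
Qed.

Lemma conv_below a b (A B i : int) :
  (forall i, i < A -> a i = 0) -> (forall i, i < B -> b i = 0) ->
  i < A + B -> conv a b i = 0.
Proof.
move=> HA HB iAB; apply: fsbig1 => j _.
have [/HA -> | Aj] := ltP j A; first by rewrite mul0r.
by rewrite HB ?mulr0 // ltrBlDr (lt_le_trans iAB) // addrC lerD2l.
Qed.

Lemma laurentM_subproof f g : bounded_below (conv f g).
Proof.
case: (lcoefP f) (lcoefP g) => [A HA] [B HB].
by exists (A + B) => i; apply: conv_below.
Qed.
Definition laurentM f g := Laurent (laurentM_subproof f g).

Fact laurent_addA : associative laurentD.
Proof. by move=> f g h; apply: laurentP => i /=; rewrite addrA. Qed.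
Fact laurent_addC : commutative laurentD.
Proof. by move=> f g; apply: laurentP => i /=; rewrite addrC. Qed.
Fact laurent_add0 : left_id laurent0 laurentD.
Proof. by move=> f; apply: laurentP => i /=; rewrite add0r. Qed.
Fact laurent_addN : left_inverse laurent0 laurentN laurentD.
Proof. by move=> f; apply: laurentP => i /=; rewrite addNr. Qed.

HB.instance Definition _ := GRing.isZmodule.Build (laurent F)
  laurent_addA laurent_addC laurent_add0 laurent_addN.

Definition tpoly (M : nat) a (A : int) : {poly F} := \poly_(j < M) a (A + j%:Z).

Lemma convE_poly M a b (A B : int) (k : nat) : (k < M)%N ->
  (forall i, i < A -> a i = 0) -> (forall i, i < B -> b i = 0) ->
  conv a b (A + B + k%:Z) = (tpoly M a A * tpoly M b B)`_k.
Proof.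
move=> kM HA HB; rewrite convE // coefM; apply: eq_bigr => j _.
rewrite !coef_poly (leq_trans (ltn_ord j)) //.
by rewrite (leq_ltn_trans (leq_subr _ _)).
Qed.

Lemma coefM_trunc M (p p' r : {poly F}) k : (k < M)%N ->
  (forall j, (j < M)%N -> p`_j = p'`_j) -> (p * r)`_k = (p' * r)`_k.
Proof.
move=> kM pp'; rewrite !coefM; apply: eq_bigr => j _; rewrite pp' //.
by rewrite (leq_trans (ltn_ord j)).
Qed.

Lemma conv_assoc a b (c : int -> F) (A B C : int) (k : nat) :
  (forall i, i < A -> a i = 0) -> (forall i, i < B -> b i = 0) ->
  (forall i, i < C -> c i = 0) ->
  conv (conv a b) c (A + B + C + k%:Z) =
  (tpoly k.+1 a A * tpoly k.+1 b B * tpoly k.+1 c C)`_k.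
Proof.
move=> HA HB HC; rewrite (@convE_poly k.+1) //; last first.
  by move=> i; apply: conv_below.
apply: (@coefM_trunc k.+1) => // j jk.
by rewrite coef_poly jk (@convE_poly k.+1).
Qed.

Fact laurent_mulC : commutative laurentM.
Proof.
move=> f g; apply: laurentP => i /=.
case: (lcoefP f) (lcoefP g) => [A HA] [B HB].
have [iAB|/int_geP[k ->]] := ltP i (A + B).
  by rewrite (conv_below HA HB iAB) (conv_below HB HA) // addrC.
by rewrite (convE_poly (ltnSn k) HA HB) [A + B]addrC (convE_poly (ltnSn k) HB HA) mulrC.
Qed.

Fact laurent_mulA : associative laurentM.
Proof.
move=> f g h; rewrite [LHS]laurent_mulC; apply: laurentP => i /=.
case: (lcoefP f) (lcoefP g) (lcoefP h) => [A HA] [B HB] [C HC].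
have HAB j : j < A + B -> conv f g j = 0 by apply: conv_below.
have HBC j : j < B + C -> conv g h j = 0 by apply: conv_below.
have [iABC|/int_geP[k ->]] := ltP i (A + B + C).
  by rewrite (conv_below HAB HC) // (conv_below HBC HA) // addrC addrA.
rewrite (conv_assoc _ HA HB HC) -[A + B + C]addrA [A + (B + C)]addrC (conv_assoc _ HB HC HA).
by rewrite mulrC mulrA.
Qed.

Definition laurent1 := laurent_mono 1 0.

Fact laurent_mul1 : left_id laurent1 laurentM.
Proof.
move=> f; apply: laurentP => i; rewrite /= /conv.
rewrite -(fsbig_widen [set 0]) ?fsbig_set1 ?eqxx ?mul1r ?subr0 //.
by move=> j [_ /= /eqP/negPf ->]; rewrite mul0r.
Qed.

Fact laurent_mulDl : left_distributive laurentM laurentD.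
Proof.
move=> f g h; apply: laurentP => i /=.
case: (lcoefP f) (lcoefP g) (lcoefP h) => [A HA] [B HB] [C HC].
pose M := Num.min A B.
have HA' j : j < M -> f j = 0 by rewrite lt_min => /andP[/HA].
have HB' j : j < M -> g j = 0 by rewrite lt_min => /andP[_ /HB].
have HD' j : j < M -> laurentD f g j = 0 by move=> jM; rewrite /= HA' ?HB' ?addr0.
have [iM|/int_geP[k ->]] := ltP i (M + C).
  by rewrite (conv_below HA' HC) ?(conv_below HB' HC) ?(conv_below HD' HC) ?addr0.
rewrite !(convE, convE _ HA' HC, convE _ HB' HC, convE _ HD' HC) //= -big_split /=.
by apply: eq_bigr => j _; rewrite mulrDl.
Qed.

Fact laurent_oner_neq0 : laurent1 != 0 :> laurent F.
Proof.
apply/eqP => /(congr1 (fun f : laurent F => f 0)) /eqP.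
by rewrite /= oner_eq0.
Qed.

HB.instance Definition _ := GRing.Zmodule_isComNzRing.Build (laurent F)
  laurent_mulA laurent_mulC laurent_mul1 laurent_mulDl laurent_oner_neq0.

Definition is_order f (n : int) := f n != 0 /\ forall i, i < n -> f i = 0.

Lemma laurent_order_exists f : f != 0 -> exists n, is_order f n.
Proof.
move=> f0; case: (lcoefP f) => A HA.
have ex : exists k : nat, f (A + k%:Z) != 0.
  apply: contrapT => Nex; case/eqP: f0; apply: laurentP => i.
  have [/HA //|/int_geP[k ->]] := ltP i A.
  by apply: contrapT => /eqP fk; apply: Nex; exists k.
exists (A + (ex_minn ex)%:Z); case: ex_minnP => k fk kmin; split=> // i ik.
have [/HA //|/int_geP[j ij]] := ltP i A; apply/eqP; rewrite ij.
apply: contraTT ik => /kmin kj; rewrite ij -leNgt lerD2l lez_nat; exact: kj.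
Qed.

Lemma conv_inverse (a : nat -> F) : a 0 != 0 -> exists b : nat -> F,
  forall k, \sum_(j < k.+1) a j * b (k - j)%N = (k == 0%N)%:R.
Proof.
move=> a0.
pose nxt k (s : seq F) :=
  (a 0)^-1 * ((k == 0%N)%:R - \sum_(j < k) a j.+1 * s`_(k - j.+1)).
pose s := fix s n := if n is k.+1 then rcons (s k) (nxt k (s k)) else [::].
have ss n : size (s n) = n by elim: n => //= n IH; rewrite size_rcons IH.
pose b k := (s k.+1)`_k.
have sb n j : (j < n)%N -> (s n)`_j = b j.
  elim: n => // n IH; rewrite ltnS leq_eqVlt => /orP[/eqP -> //|jn].
  by rewrite /= nth_rcons ss jn IH.
exists b => k; rewrite big_ord_recl subn0 /=.
have -> : b k = nxt k (s k) by rewrite /b /= nth_rcons ss ltnn eqxx.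
rewrite /nxt mulVKf // -[RHS]addr0 -addrA; congr (_ + _).
apply/eqP; rewrite addrC subr_eq0; apply/eqP; apply: eq_bigr => j _.
by rewrite sb // ltn_subrL /=; case: k j => // - [].
Qed.

Lemma laurent_inv_exists f : f != 0 -> exists g, g * f = 1.
Proof.
move=> /laurent_order_exists[n [fn Hf]].
have [|b Hb] := @conv_inverse (fun j => f (n + j%:Z)); first by rewrite addr0.
pose c (i : int) := if i + n is Posz j then b j else 0.
have Hc i : i < - n -> c i = 0.
  by rewrite -subr_lt0 opprK /c; case: (i + n).
exists (Laurent (ex_intro _ _ Hc)); rewrite mulrC; apply: laurentP => i.
rewrite [LHS]/= /conv -/(conv f c i).
have [i0|/int_geP[k ->]] := ltP i (n - n).
  rewrite (conv_below Hf Hc) //= ifN //.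
  by apply: contraTneq i0 => ->; rewrite subrr ltxx.
rewrite (convE _ Hf Hc) /= subrr add0r eqz_nat.
transitivity ((k == 0%N)%:R : F); last by case: eqP.
rewrite -Hb; apply: eq_bigr => j _; congr (_ * _).
by rewrite /c addrAC addNr add0r.
Qed.

Definition laurentV f : laurent F := xget 0 [set g | g * f = 1].

Fact laurent_mulVf f : f != 0 -> laurentV f * f = 1.
Proof. by move=> /laurent_inv_exists/(xgetPex 0). Qed.

Fact laurent_inv0 : laurentV 0 = 0.
Proof.
apply: xgetPN => g /= /eqP; rewrite mulr0 eq_sym => /eqP H.
by have := oner_neq0 (laurent F); rewrite H eqxx.
Qed.

HB.instance Definition _ := GRing.ComNzRing_isField.Build (laurent F)
  laurent_mulVf laurent_inv0.

End LaurentField.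

Definition laurent_order (F : fieldType) (t : laurent F) : int :=
  xget 0 [set n | is_order t n].

Definition laurent_abs (R : realType) (F : finFieldType) (t : laurent F) : R :=
  if t == 0 then 0 else (#|F|%:R : R) ^ (- laurent_order t).

Definition laurentX (F : fieldType) : laurent F := laurent_mono 1 1.

Definition carlitz_bracket (F : finFieldType) (i : nat) : laurent F :=
  laurentX F ^+ (#|F| ^ i) - laurentX F.

Definition carlitz_factorial (F : finFieldType) (i : nat) : laurent F :=
  \prod_(j < i) carlitz_bracket F (i - j) ^+ (#|F| ^ j).

Definition is_algebraic_closure (K L : fieldType) (j : {rmorphism K -> L}) :=
  GRing.closed_field_axiom L /\ forall u : L, algebraicOver j u.

Definition is_nonarch_abs (R : realType) (L : fieldType) (v : L -> R) :=
  [/\ forall a, 0 <= v a,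
      forall a, v a = 0 <-> a = 0,
      forall a b, v (a * b) = v a * v b &
      forall a b, v (a + b) <= Num.max (v a) (v b)].

Definition is_complete (R : realType) (L : fieldType) (v : L -> R) :=
  forall s : nat -> L,
    (forall e, 0 < e -> exists N, forall m n,
       (N <= m)%N -> (N <= n)%N -> v (s m - s n) < e) ->
    exists l, (fun n => v (s n - l)) @ \oo --> (0 : R).

(* C, with the absolute value v, is the completion of the algebraic closure
   Kbar of K = F((x)), and v extends the absolute value of K. *)
Record is_completed_closure (R : realType) (F : finFieldType)
    (Kbar C : fieldType) (j : {rmorphism laurent F -> Kbar})
    (i : {rmorphism Kbar -> C}) (v : C -> R) : Prop := CompletedClosure {
  cc_closure : is_algebraic_closure j ;
  cc_abs : is_nonarch_abs v ;
  cc_extends : forall t : laurent F, v (i (j t)) = laurent_abs R t ;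
  cc_dense : forall (z : C) e, 0 < e -> exists a : Kbar, v (z - i a) < e ;
  cc_complete : is_complete v }.

Section CarlitzEquation.
Variables (R : realType) (F : finFieldType) (C : fieldType).
(* [k] is the embedding of F((x)) in C, [v] the absolute value of C. *)
Variables (k : {rmorphism laurent F -> C}) (v : C -> R) (m : nat).

Definition vnorm (z : 'cV[C]_m) : R := \big[Num.max/0]_(i < m) v (z i 0).

Definition vcvg (s : nat -> 'cV[C]_m) (l : 'cV[C]_m) :=
  (fun n => vnorm (s n - l)) @ \oo --> (0 : R).

Definition has_sum (a : nat -> 'cV[C]_m) := vcvg (fun n => \sum_(i < n) a i).

Definition vsummable (a : nat -> 'cV[C]_m) := exists l, has_sum a l.

(* Junk value 0 for a divergent series. *)
Definition vsum (a : nat -> 'cV[C]_m) : 'cV[C]_m := xget 0 (has_sum a).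

Definition tau_iter (n : nat) (z : 'cV[C]_m) : 'cV[C]_m :=
  map_mx (fun u => u ^+ (#|F| ^ n)) z.

(* Junk value 0 when there is no q-th root; in the completed algebraic closure
   each element has exactly one. *)
Definition qroot (u : C) : C := xget 0 [set w | w ^+ #|F| = u].

Definition carlitz_d (u : laurent F -> 'cV[C]_m) (t : laurent F) : 'cV[C]_m :=
  map_mx qroot (u (laurentX F * t) - k (laurentX F) *: u t).

Definition carlitz_term (c : nat -> 'cV[C]_m) (t : laurent F) (i : nat) :
    'cV[C]_m :=
  k (t ^+ (#|F| ^ i) / carlitz_factorial F i) *: c i.

Definition carlitz_series (c : nat -> 'cV[C]_m) (t : laurent F) : 'cV[C]_m :=
  vsum (carlitz_term c t).

Definition carlitz_pos_radius (c : nat -> 'cV[C]_m) :=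
  exists2 r : R, 0 < r &
    forall t, laurent_abs R t < r -> vsummable (carlitz_term c t).

Definition tau_term (pi : nat -> 'M[C]_m) (z : 'cV[C]_m) (n : nat) :
    'cV[C]_m :=
  pi n *m tau_iter n z.

Definition tau_series (pi : nat -> 'M[C]_m) (z : 'cV[C]_m) : 'cV[C]_m :=
  vsum (tau_term pi z).

Definition tau_pos_radius (pi : nat -> 'M[C]_m) :=
  exists2 r : R, 0 < r &
    forall z, vnorm z < r -> vsummable (tau_term pi z).

(* The summability clauses keep the junk value of [vsum] out of the equation. *)
Definition local_solution (pi : nat -> 'M[C]_m) (phi : nat -> 'cV[C]_m)
    (u : laurent F -> 'cV[C]_m) :=
  exists2 r : R, 0 < r & forall t, laurent_abs R t < r ->
    [/\ vsummable (tau_term pi (u t)), vsummable (carlitz_term phi t) &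
        carlitz_d u t = tau_series pi (u t) + carlitz_series phi t].

Definition initial_condition (u : laurent F -> 'cV[C]_m) (y0 : 'cV[C]_m) :=
  forall e : R, 0 < e -> exists2 r : R, 0 < r &
    forall t, t != 0 -> laurent_abs R t < r ->
      vnorm ((k t)^-1 *: u t - y0) < e.

End CarlitzEquation.

(* Main.v *)
(* Since D_(l+1) = [l+1] D_l^q, the operator d shifts coefficients: dy has coefficients
   y_(l+1)^(1/q), and P(tau)y has coefficients
   sum_(h <= l) (D_l / D_(l-h)^(q^h)) pi_h y_(l-h)^(q^h).  Comparing coefficients turns the
   equation into a recurrence determining y from y_0.  As |D_l / D_(l-h)^(q^h)| <= 1 and
   positive radius of convergence means that the l-th coefficient is O(G^(q^l)), the
   recurrence gives |y_l| <= E^(3 q^l - 2).  Conversely, the coefficients of a series are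
   determined by its values on small t, so every solution satisfies the recurrence. *)
Require Import Defs.
From mathcomp Require Import all_boot all_order all_algebra all_field.
From mathcomp Require Import all_classical all_reals all_analysis.
From mathcomp Require Import zify.

Set Implicit Arguments.
Unset Strict Implicit.
Unset Printing Implicit Defensive.

Import Order.TTheory GRing.Theory Num.Theory.
Import numFieldNormedType.Exports.
Local Open Scope classical_set_scope.
Local Open Scope ring_scope.

(** * Elementary properties of a non-archimedean absolute value *)

Section Ultrametric.
Variables (R : realType) (L : fieldType) (v : L -> R).
Hypothesis hv : is_nonarch_abs v.

Lemma abs_ge0 a : 0 <= v a. Proof. by case: hv. Qed.

Lemma abs_eq0 a : (v a == 0) = (a == 0).
Proof. by case: hv => _ v0 _ _; apply/eqP/eqP => /v0. Qed.

Lemma abs0 : v 0 = 0. Proof. by apply/eqP; rewrite abs_eq0. Qed.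

Lemma absM a b : v (a * b) = v a * v b. Proof. by case: hv. Qed.

Lemma absD_max a b : v (a + b) <= Num.max (v a) (v b). Proof. by case: hv. Qed.

Lemma abs1 : v 1 = 1.
Proof.
have n0 : v 1 != 0 by rewrite abs_eq0 oner_eq0.
by apply: (mulfI n0); rewrite -absM !mulr1.
Qed.

Lemma absX a n : v (a ^+ n) = v a ^+ n.
Proof. by elim: n => [|n IH]; rewrite ?expr0 ?abs1 // !exprS absM IH. Qed.

Lemma absV a : v a^-1 = (v a)^-1.
Proof.
have [->|a0] := eqVneq a 0; first by rewrite invr0 abs0 invr0.
have va0 : v a != 0 by rewrite abs_eq0.
by apply: (mulfI va0); rewrite -absM !mulfV // abs1.
Qed.

Lemma absN a : v (- a) = v a.
Proof.
suff v1 : v (-1) = 1 by rewrite -mulN1r absM v1 mul1r.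
by apply: (@pexpIrn _ 2) => //; rewrite ?nnegrE ?abs_ge0 ?ler01 // -absX sqrrN !expr1n abs1.
Qed.

Lemma absB_max a b : v (a - b) <= Num.max (v a) (v b).
Proof. by rewrite -(absN b) absD_max. Qed.

Lemma absB a b : v (a - b) = v (b - a).
Proof. by rewrite -absN opprB. Qed.

(** The ultrametric inequality for [a = (a + b) - b] gives the lower bound, since [v b] alone cannot
    dominate [v a]. *)
Lemma abs_addl a b : v b < v a -> v (a + b) = v a.
Proof.
move=> ba; apply/eqP; rewrite eq_le; apply/andP; split.
  by rewrite (le_trans (absD_max _ _)) // ge_max lexx ltW.
have := absB_max (a + b) b; rewrite addrK le_max => /orP[//|].
by rewrite leNgt ba.
Qed.

(** * The maximum norm, limits and series of vectors *)

Section Vector.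
Variable m : nat.
Implicit Types (z w : 'cV[L]_m) (a s : nat -> 'cV[L]_m).

Lemma vnorm_leP z (e : R) :
  reflect (0 <= e /\ forall i, v (z i 0) <= e) (vnorm v z <= e).
Proof.
by rewrite /vnorm; apply: (iffP (bigmax_leP _ _ _ _)) => -[e0 He]; split=> // i *; apply: He.
Qed.

Lemma vnorm_ge0 z : 0 <= vnorm v z.
Proof. exact: bigmax_ge_id. Qed.

Lemma abs_le_vnorm z i : v (z i 0) <= vnorm v z.
Proof. by have /vnorm_leP[_] := lexx (vnorm v z). Qed.

Lemma vnorm_le z (e : R) : 0 <= e -> (forall i, v (z i 0) <= e) -> vnorm v z <= e.
Proof. by move=> e0 He; apply/vnorm_leP. Qed.

Lemma vnorm_eq0 z : vnorm v z = 0 -> z = 0.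
Proof.
move=> z0; apply/colP => i; rewrite mxE; apply/eqP.
by rewrite -abs_eq0 eq_le abs_ge0 andbT -z0 abs_le_vnorm.
Qed.

Lemma vnorm0 : vnorm v (0 : 'cV[L]_m) = 0.
Proof.
apply/eqP; rewrite eq_le vnorm_ge0 andbT; apply: vnorm_le => // i.
by rewrite mxE abs0.
Qed.

Lemma vnormN z : vnorm v (- z) = vnorm v z.
Proof. by apply: eq_bigr => i _; rewrite mxE absN. Qed.

Lemma vnormB z w : vnorm v (z - w) = vnorm v (w - z).
Proof. by rewrite -vnormN opprB. Qed.

Lemma vnormD_le z w (e : R) :
  vnorm v z <= e -> vnorm v w <= e -> vnorm v (z + w) <= e.
Proof.
move=> /vnorm_leP[e0 ze] /vnorm_leP[_ we]; apply: vnorm_le => // i.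
by rewrite mxE (le_trans (absD_max _ _)) // ge_max ze we.
Qed.

Lemma vnormB_le z w (e : R) :
  vnorm v z <= e -> vnorm v w <= e -> vnorm v (z - w) <= e.
Proof. by move=> ze we; rewrite vnormD_le // vnormN. Qed.

Lemma vnorm_dist_le w z z' (e : R) :
  vnorm v (z - w) <= e -> vnorm v (w - z') <= e -> vnorm v (z - z') <= e.
Proof. by move=> h1 h2; rewrite -(subrK w z) -addrA vnormD_le. Qed.

Lemma vnorm_sum_le (I : Type) (r : seq I) (P : pred I) (f : I -> 'cV[L]_m) (e : R) :
  0 <= e -> (forall i, P i -> vnorm v (f i) <= e) ->
  vnorm v (\sum_(i <- r | P i) f i) <= e.
Proof.
move=> e0 fe; elim/big_ind: _ => [|x y|i /fe //]; first by rewrite vnorm0.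
exact: vnormD_le.
Qed.

Lemma vnormZ c z : vnorm v (c *: z) = v c * vnorm v z.
Proof.
have [->|c0] := eqVneq c 0; first by rewrite scale0r vnorm0 abs0 mul0r.
have vc : 0 < v c by rewrite lt_def abs_eq0 c0 abs_ge0.
apply/eqP; rewrite eq_le -[X in _ && X]ler_pdivlMl //; apply/andP; split.
  apply: vnorm_le => [|i]; first by rewrite mulr_ge0 ?abs_ge0 ?vnorm_ge0.
  by rewrite mxE absM ler_wpM2l ?abs_ge0 ?abs_le_vnorm.
apply: vnorm_le => [|i]; first by rewrite mulr_ge0 ?invr_ge0 ?abs_ge0 ?vnorm_ge0.
by rewrite ler_pdivlMl // -absM; have := abs_le_vnorm (c *: z) i; rewrite mxE.
Qed.

Lemma vcvgP s z : vcvg v s z <->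
  forall e : R, 0 < e -> exists N, forall n, (N <= n)%N -> vnorm v (s n - z) < e.
Proof.
split=> [/cvgrPdist_lt cs e e0|H].
  have [N _ HN] := cs e e0; exists N => n Nn.
  by have := HN n Nn; rewrite /= sub0r normrN ger0_norm // vnorm_ge0.
apply/cvgrPdist_lt => e e0; have [N HN] := H e e0; exists N => // n Nn /=.
by rewrite sub0r normrN ger0_norm ?vnorm_ge0 // HN.
Qed.

Lemma vcvg_squeeze s z (b : nat -> R) : b @ \oo --> (0 : R) ->
  (forall n, vnorm v (s n - z) <= b n) -> vcvg v s z.
Proof.
move=> b0 sb; apply: (@squeeze_cvgr _ _ _ _ (fun=> 0) b) b0; last exact: cvg_cst.
by near=> n; rewrite vnorm_ge0 sb.
Unshelve. all: by end_near. Qed.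

(** Closed balls are closed under limits: a term closer to [z] than [w] is would contradict the
    ultrametric inequality if [z] lay outside the ball. *)
Lemma vcvg_dist_le s z w (e : R) N : vcvg v s z ->
  (forall n, (N <= n)%N -> vnorm v (s n - w) <= e) -> vnorm v (z - w) <= e.
Proof.
move=> /vcvgP cs sw; rewrite leNgt; apply/negP => ew.
have e0 : 0 <= e by rewrite (le_trans (vnorm_ge0 _) (sw N _)).
have [M HM] := cs _ (le_lt_trans e0 ew).
have := HM _ (leq_maxr N M); rewrite vnormB.
have := sw _ (leq_maxl N M); set n := maxn _ _ => swn sz.
have : vnorm v (z - w) <= Num.max (vnorm v (z - s n)) (vnorm v (s n - w)).
  by apply: (@vnorm_dist_le (s n)); rewrite le_max lexx ?orbT.
by rewrite le_max leNgt sz /= leNgt (le_lt_trans swn ew).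
Qed.

Lemma vcvg_unique s z w : vcvg v s z -> vcvg v s w -> z = w.
Proof.
move=> sz /vcvgP sw; apply/eqP; rewrite -subr_eq0; apply/eqP/vnorm_eq0/eqP.
rewrite eq_le vnorm_ge0 andbT; apply/ler_addgt0Pl => e e0; rewrite addr0.
have [N HN] := sw _ e0; apply: (vcvg_dist_le sz (N := N)) => n Nn.
exact/ltW/HN.
Qed.

Lemma vcvgB s s' z z' : vcvg v s z -> vcvg v s' z' ->
  vcvg v (fun n => s n - s' n) (z - z').
Proof.
move=> /vcvgP cs /vcvgP cs'; apply/vcvgP => e e0.
have [N HN] := cs _ e0; have [N' HN'] := cs' _ e0.
exists (maxn N N') => n; rewrite geq_max => /andP[/HN h /HN' h'].
have [d [d1 d2 de]] : exists d, [/\ vnorm v (s n - z) <= d, vnorm v (s' n - z') <= d & d < e].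
  exists (Num.max (vnorm v (s n - z)) (vnorm v (s' n - z'))).
  by rewrite !le_max !lexx orbT gt_max h h'.
rewrite opprB [z' - z]addrC addrACA [- s' n + z']addrC -[z' - _]opprB.
by rewrite (le_lt_trans _ de) // vnormB_le.
Qed.

Lemma vcvgZ c s z : vcvg v s z -> vcvg v (fun n => c *: s n) (c *: z).
Proof.
move=> /vcvgP cs; apply/vcvgP => e e0.
have [N HN] := cs (e / (v c + 1)) (divr_gt0 e0 (ltr_wpDl (abs_ge0 _) ltr01)).
exists N => n /HN; rewrite ltr_pdivlMr ?ltr_wpDl ?abs_ge0 // => h.
rewrite -scalerBr vnormZ; apply: le_lt_trans h.
by rewrite mulrC ler_wpM2l ?vnorm_ge0 // lerDl.
Qed.

Lemma has_sum_unique a z w : has_sum v a z -> has_sum v a w -> z = w.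
Proof. exact: vcvg_unique. Qed.

Lemma vsumE a z : has_sum v a z -> vsum v a = z.
Proof. by move=> az; apply: xget_unique => // w /has_sum_unique; apply. Qed.

Lemma eq_has_sum a a' z : a =1 a' -> has_sum v a z -> has_sum v a' z.
Proof. by move=> /funext ->. Qed.

Lemma has_sumB a a' z z' : has_sum v a z -> has_sum v a' z' ->
  has_sum v (fun n => a n - a' n) (z - z').
Proof.
move=> ha ha'; rewrite /has_sum.
under eq_fun do rewrite sumrB.
exact: vcvgB.
Qed.

Lemma has_sumN a z : has_sum v a z -> has_sum v (fun n => - a n) (- z).
Proof.
move=> ha; rewrite -sub0r; apply: eq_has_sum (has_sumB (a := fun=> 0) _ ha).
  by move=> n; rewrite /= sub0r.
apply/vcvgP => e e0; exists 0%N => n _.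
by rewrite big1 // subrr vnorm0.
Qed.

Lemma has_sumD a a' z z' : has_sum v a z -> has_sum v a' z' ->
  has_sum v (fun n => a n + a' n) (z + z').
Proof.
move=> ha /has_sumN ha'; rewrite -[z']opprK.
by apply: eq_has_sum (has_sumB ha ha') => n; rewrite opprK.
Qed.

Lemma has_sumZ c a z : has_sum v a z -> has_sum v (fun n => c *: a n) (c *: z).
Proof.
move=> ha; rewrite /has_sum.
under eq_fun do rewrite -scaler_sumr.
exact: vcvgZ.
Qed.

Lemma has_sum_shift a z : a 0 = 0 -> has_sum v a z -> has_sum v (a \o S) z.
Proof.
move=> a0 /vcvgP ha; apply/vcvgP => e /ha[N HN]; exists N => n Nn.
by have := HN n.+1 (leqW Nn); rewrite big_ord_recl a0 add0r.
Qed.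

Lemma has_sum_bounded a z : has_sum v a z -> exists M : R, forall n, vnorm v (a n) <= M.
Proof.
move=> /vcvgP /(_ 1 ltr01)[N HN].
exists (\big[Num.max/1]_(n < N) vnorm v (a n)) => n.
have [nN|Nn] := ltnP n N; first exact: (le_bigmax _ (fun i : 'I_N => vnorm v (a i)) (Ordinal nN)).
apply: le_trans (bigmax_ge_id _ _ _ _).
have -> : a n = (\sum_(i < n.+1) a i - z) - (\sum_(i < n) a i - z).
  by rewrite big_ord_recr /= opprB addrA subrK addrC addKr.
by rewrite vnormB_le // ltW // HN // leqW.
Qed.

(** * Convergence of series dominated by a nonincreasing null sequence *)

Section Majorant.
Variables (b : nat -> R) (a : nat -> 'cV[L]_m).
Hypothesis b_noninc : forall i j, (i <= j)%N -> b j <= b i.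
Hypothesis b_cvg0 : b @ \oo --> (0 : R).
Hypothesis ab : forall i, vnorm v (a i) <= b i.

(** A block of terms is no larger than its largest term, hence than the majorant at its first
    index. *)
Lemma partial_sum_dist n n' : (n <= n')%N ->
  vnorm v (\sum_(i < n') a i - \sum_(i < n) a i) <= b n.
Proof.
move=> nn'; rewrite -!(big_mkord xpredT a) (big_cat_nat (leq0n n) nn') /= addrAC subrr add0r.
rewrite big_seq; apply: vnorm_sum_le => [|i].
  by rewrite (le_trans (vnorm_ge0 (a n))).
by rewrite mem_index_iota => /andP[ni _]; rewrite (le_trans (ab i)) ?b_noninc.
Qed.

Lemma has_sum_tail_le z n : has_sum v a z -> vnorm v (z - \sum_(i < n) a i) <= b n.
Proof. by move=> az; apply: (vcvg_dist_le az) => n' /partial_sum_dist; apply. Qed.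

Lemma has_sum_majorant : is_complete v -> exists z, has_sum v a z.
Proof.
move=> hc.
have /choice[l Hl] : forall i : 'I_m, exists l : L,
    (fun n => v ((\sum_(h < n) a h) i 0 - l)) @ \oo --> (0 : R).
  move=> i; apply: hc => e e0; have /cvgrPdist_lt/(_ e e0)[N _ HN] := b_cvg0.
  exists N => n n' Nn Nn'; have := HN N (leqnn N) => /=; rewrite sub0r normrN => bN.
  apply: le_lt_trans (le_lt_trans (ler_norm _) bN).
  have key : vnorm v (\sum_(h < n) a h - \sum_(h < n') a h) <= b N.
    by apply: (@vnorm_dist_le (\sum_(h < N) a h)); [|rewrite vnormB]; apply: partial_sum_dist.
  by have := le_trans (abs_le_vnorm _ i) key; rewrite !mxE.
exists (\col_i l i); apply: (vcvg_squeeze b_cvg0) => n.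
apply: vnorm_le => [|i]; first by rewrite (le_trans (vnorm_ge0 (a n))).
(* Were a coordinate of the [n]-th partial sum farther than [b n] from its limit, a later partial
   sum, within [b n] of the [n]-th and closer to the limit than that distance, would violate the
   ultrametric inequality. *)
rewrite !mxE leNgt; apply/negP => bv.
have /cvgrPdist_lt/(_ _ (le_lt_trans _ bv))[|N _ HN] := Hl i.
  by rewrite (le_trans (vnorm_ge0 (a n))).
have := HN _ (leq_maxr n N) => /=; rewrite sub0r normrN ger0_norm ?abs_ge0 //.
have := le_trans (abs_le_vnorm _ i) (partial_sum_dist (leq_maxl n N)).
rewrite !mxE; set S := \sum_(h < maxn _ _) _; set T := \sum_(h < n) _ => h1 h2.
have := absB_max (S i 0 - l i) (S i 0 - T i 0).
rewrite opprB [_ - _ + _]addrC addrA subrK le_max [in X in X || _]leNgt h2 /= leNgt.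
by rewrite (le_lt_trans h1 bv).
Qed.

End Majorant.

Lemma vcvg_pow (g : 'cV[L]_m -> 'cV[L]_m) (s : nat -> 'cV[L]_m) z (n : nat) :
  (0 < n)%N -> (forall x y, vnorm v (g x - g y) = vnorm v (x - y) ^+ n) ->
  vcvg v s z -> vcvg v (g \o s) (g z).
Proof.
move=> n0 gn /vcvgP cs; apply/vcvgP => e e0.
(* The cap at 1 makes the [n]-th power of the distance at most the distance itself. *)
have [N HN] := cs (Num.min e 1) ltac:(by rewrite lt_min e0 ltr01).
exists N => k /HN; rewrite lt_min => /andP[h1 h2] /=; rewrite gn.
apply: le_lt_trans h1; rewrite -[leRHS]expr1 ler_wiXn2l ?vnorm_ge0 //.
exact: ltW.
Qed.

End Vector.
End Ultrametric.

(** * Order and characteristic of Laurent series *)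

Lemma is_order_unique (F : fieldType) (t : laurent F) (a b : int) :
  is_order t a -> is_order t b -> a = b.
Proof.
by move=> [ta Ha] [tb Hb]; have [/Hb /eqP|/Ha /eqP|//] := ltgtP a b; rewrite ?(negbTE ta) ?(negbTE tb).
Qed.

Lemma pchar_laurent (F : fieldType) p : p \in [pchar F] -> p \in [pchar laurent F].
Proof.
move=> /andP[pp /eqP pF]; apply/andP; split=> //; apply/eqP/laurentP => i.
have coefMn (t : laurent F) n : (t *+ n) i = t i *+ n.
  by elim: n => // n IH; rewrite !mulrS /= IH.
by rewrite coefMn /= -mulr_natr pF mulr0.
Qed.

(** * Absolute values of the Carlitz factorials *)

Section CarlitzFactorial.
Variables (R : realType) (F : finFieldType) (L : fieldType).
Variables (k : {rmorphism laurent F -> L}) (v : L -> R).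
Hypothesis hv : is_nonarch_abs v.
Hypothesis hk : forall t, v (k t) = laurent_abs R t.

Local Notation q := #|F|.
Local Notation Q := (#|F|%:R : R).
Local Notation X := (laurentX F).
Local Notation D := (carlitz_factorial F).

Lemma card_gt1 : (1 < q)%N. Proof. exact: card_finNzRing_gt1. Qed.

Lemma card_gt0 : (0 < q)%N. Proof. exact: ltnW card_gt1. Qed.

Lemma cardR_gt1 : 1 < Q. Proof. by rewrite ltr1n card_gt1. Qed.

Lemma cardR_gt0 : 0 < Q. Proof. exact: lt_trans cardR_gt1. Qed.

Lemma card_expn_gt0 i : (0 < q ^ i)%N. Proof. by rewrite expn_gt0 card_gt0. Qed.

Lemma abs_X : v (k X) = Q^-1.
Proof.
have oX : is_order X 1.
  split=> [|i i1]; first by rewrite /laurentX /= oner_eq0.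
  by rewrite /laurentX /= ifN // lt_eqF.
have X0 : X != 0 by apply: contra_neq oX.1 => ->.
rewrite hk /laurent_abs (negbTE X0) /laurent_order.
by rewrite (xget_unique _ oX) // => n /is_order_unique; apply.
Qed.

Lemma abs_X_lt1 : v (k X) < 1.
Proof. by rewrite abs_X invf_lt1 ?cardR_gt0 ?cardR_gt1. Qed.

Lemma exists_small (r : R) : 0 < r -> exists2 t : laurent F, t != 0 & v (k t) < r.
Proof.
move=> r0; have /cvgrPdist_lt/(_ r r0)[N _ HN] : (fun n => v (k X) ^+ n) @ \oo --> (0 : R).
  by apply: cvg_expr; rewrite ger0_norm ?(abs_ge0 hv) ?abs_X_lt1.
exists (X ^+ N).
  rewrite expf_neq0 // -(fmorph_eq0 k) -(abs_eq0 hv) abs_X invr_eq0.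
  by rewrite gt_eqF ?cardR_gt0.
have := HN N (leqnn N); rewrite /= sub0r normrN ger0_norm ?exprn_ge0 ?(abs_ge0 hv) //.
by rewrite rmorphXn absX.
Qed.

(** The power [x ^ (q ^ i.+1)] is strictly smaller than [x], so [x] alone decides the absolute
    value. *)
Lemma abs_bracket i : v (k (carlitz_bracket F i.+1)) = Q^-1.
Proof.
rewrite /carlitz_bracket rmorphB rmorphXn /= addrC abs_addl ?absN // ?abs_X // absX //.
rewrite abs_X -[ltRHS]expr1 ltr_iXn2l ?invf_lt1 ?invr_gt0 ?cardR_gt0 ?cardR_gt1 //.
by rewrite -(expn0 q) ltn_exp2l ?card_gt1.
Qed.

Lemma carlitz_factorial0 : D 0 = 1. Proof. by rewrite /carlitz_factorial big_ord0. Qed.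

(** Once the factor of index 0 is split off, every remaining exponent is divisible by [q], and the
    rest is the [q]-th power of [D i]. *)
Lemma carlitz_factorialS i : D i.+1 = carlitz_bracket F i.+1 * D i ^+ q.
Proof.
rewrite /carlitz_factorial big_ord_recl subn0 expn0 expr1 -prodrXl.
by congr (_ * _); apply: eq_bigr => h _; rewrite subSS expnSr exprM.
Qed.

Lemma abs_factorial_gt0 i : 0 < v (k (D i)).
Proof.
elim: i => [|i IH]; first by rewrite carlitz_factorial0 rmorph1 abs1.
by rewrite carlitz_factorialS rmorphM rmorphXn absM // absX // abs_bracket
           mulr_gt0 ?exprn_gt0 // invr_gt0 cardR_gt0.
Qed.

Lemma carlitz_factorial_neq0 i : D i != 0.
Proof. by rewrite -(fmorph_eq0 k) -(abs_eq0 hv) gt_eqF ?abs_factorial_gt0. Qed.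

Lemma abs_factorialV_le i : (v (k (D i)))^-1 <= Q ^+ (q ^ i).
Proof.
(* The factor [Q] makes the induction go through: [2 <= q] gives [Q ^ 2 <= Q ^ q]. *)
suff H : (v (k (D i)))^-1 * Q <= Q ^+ (q ^ i).
  apply: le_trans H; rewrite ler_peMr ?invr_ge0 ?(abs_ge0 hv) //.
  exact: ltW cardR_gt1.
elim: i => [|i IH].
  by rewrite carlitz_factorial0 rmorph1 abs1 // invr1 mul1r expn0 expr1.
rewrite carlitz_factorialS rmorphM rmorphXn absM // absX // abs_bracket.
rewrite invfM invrK expnSr exprM.
apply: le_trans (lerXn2r q _ _ IH); rewrite ?nnegrE ?mulr_ge0 ?invr_ge0 ?exprn_ge0 ?ler0n ?(abs_ge0 hv) //.
rewrite exprMn mulrAC mulrC exprVn ler_wpM2l ?invr_ge0 ?exprn_ge0 ?(abs_ge0 hv) //.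
by rewrite -expr2 ler_weXn2l ?card_gt1 // ltW ?cardR_gt1.
Qed.

(** Each step of the recurrence for [D] takes a [q]-th power and multiplies by a bracket of absolute
    value [1 / q]. This bounds by 1 the quotients of factorials that occur in [tau_coef]. *)
Lemma abs_factorialD_le n l : v (k (D (n + l))) <= v (k (D n)) ^+ (q ^ l).
Proof.
elim: l => [|l IH]; first by rewrite addn0 expn0 expr1.
rewrite addnS carlitz_factorialS rmorphM rmorphXn absM // absX // abs_bracket.
rewrite expnSr exprM -[leRHS]mul1r ler_pM ?invr_ge0 ?ler0n ?exprn_ge0 ?(abs_ge0 hv) //.
  by rewrite invf_le1 ?cardR_gt0 // ltW ?cardR_gt1.
by rewrite lerXn2r ?nnegrE ?exprn_ge0 ?(abs_ge0 hv).
Qed.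

Lemma abs_factorial_le1 i : v (k (D i)) <= 1.
Proof. by have := abs_factorialD_le 0 i; rewrite carlitz_factorial0 rmorph1 abs1 // expr1n. Qed.

Lemma cvg_expr_card (s : R) : 0 <= s < 1 -> (fun n => s ^+ (q ^ n)) @ \oo --> (0 : R).
Proof.
move=> /andP[s0 s1]; have := @cvg_expr R s; rewrite ger0_norm // => /(_ s1).
apply: (@squeeze_cvgr _ _ _ _ (fun=> 0)); last exact: cvg_cst.
apply: nearW => n; rewrite exprn_ge0 //= ler_wiXn2l // ?ltW //.
by apply: ltnW; rewrite ltn_expl ?card_gt1.
Qed.

Lemma expr_card_noninc (s : R) : 0 <= s < 1 ->
  forall i h, (i <= h)%N -> s ^+ (q ^ h) <= s ^+ (q ^ i).
Proof.
move=> /andP[s0 s1] i h ih; apply: ler_wiXn2l; rewrite ?(ltW s1) //.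
exact: leq_pexp2l card_gt0 ih.
Qed.

(** * Powers of Frobenius, Carlitz series and the growth of their coefficients *)

Section Vector.
Variable m : nat.
Implicit Types (z w : 'cV[L]_m) (c y phi : nat -> 'cV[L]_m).
Hypothesis frob : forall n (a b : L), (a + b) ^+ (q ^ n) = a ^+ (q ^ n) + b ^+ (q ^ n).
Hypothesis hc : is_complete v.

(* Equivalent to a positive radius of convergence, because [1 <= |1 / D i| <= q ^ (q ^ i)]. *)
Definition card_bounded c (G : R) := forall i, vnorm v (c i) <= G ^+ (q ^ i).

Lemma vnorm_tau n z : vnorm v (tau_iter F n z) = vnorm v z ^+ (q ^ n).
Proof.
apply/eqP; rewrite eq_le; apply/andP; split.
  apply: vnorm_le => [|i]; first by rewrite exprn_ge0 ?vnorm_ge0.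
  by rewrite mxE absX // lerXn2r ?nnegrE ?vnorm_ge0 ?(abs_ge0 hv) // abs_le_vnorm.
(* The maximum is attained at a coordinate unless it is the initial value 0 of the iterated maximum,
   as happens for the empty vector. *)
have [[i ->]|->] : (exists i, vnorm v z = v (z i 0)) \/ vnorm v z = 0.
- rewrite /vnorm; elim/big_ind: _ => [|x y hx hy|i _]; first by right.
  + by rewrite Order.POrderTheory.maxEle; case: ifP.
  + by left; exists i.
- by have := abs_le_vnorm v (tau_iter F n z) i; rewrite mxE absX.
- by rewrite expr0n gtn_eqF ?card_expn_gt0 ?vnorm_ge0.
Qed.

Lemma tauD n z w : tau_iter F n (z + w) = tau_iter F n z + tau_iter F n w.
Proof. by apply/colP => i; rewrite !mxE frob. Qed.

Lemma tauB n z w : tau_iter F n (z - w) = tau_iter F n z - tau_iter F n w.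
Proof. by apply/eqP; rewrite eq_sym subr_eq -tauD subrK. Qed.

Lemma tauZ n (b : L) z : tau_iter F n (b *: z) = b ^+ (q ^ n) *: tau_iter F n z.
Proof. by apply/colP => i; rewrite !mxE exprMn. Qed.

Lemma tau0 n : tau_iter F n (0 : 'cV[L]_m) = 0.
Proof. by rewrite -[X in tau_iter F n X](subrr 0) tauB subrr. Qed.

Lemma tau_sum n (I : Type) (r : seq I) (P : pred I) (f : I -> 'cV[L]_m) :
  tau_iter F n (\sum_(i <- r | P i) f i) = \sum_(i <- r | P i) tau_iter F n (f i).
Proof. exact: (big_morph _ (tauD n) (tau0 n)). Qed.

Lemma tau_inj n : injective (@tau_iter F L m n).
Proof.
move=> z w zw; apply/eqP; rewrite -subr_eq0; apply/eqP/(vnorm_eq0 hv)/eqP.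
have := vnorm_tau n (z - w); rewrite tauB zw subrr vnorm0 // => /esym/eqP.
by rewrite expf_eq0 => /andP[].
Qed.

Lemma has_sum_tau n a z : has_sum v a z ->
  has_sum v (fun i => tau_iter F n (a i)) (tau_iter F n z).
Proof.
move=> az; rewrite /has_sum; under eq_fun do rewrite -tau_sum.
refine (vcvg_pow (g := @tau_iter F L m n) (card_expn_gt0 n) _ az) => x y.
by rewrite -tauB vnorm_tau.
Qed.

Lemma vnorm_carlitz_term c t i : vnorm v (carlitz_term k c t i) =
  v (k t) ^+ (q ^ i) * (v (k (D i)))^-1 * vnorm v (c i).
Proof. by rewrite vnormZ // rmorphM absM // fmorphV absV // rmorphXn absX. Qed.

Lemma carlitz_term_le c (G : R) t i : 0 <= G -> card_bounded c G ->
  vnorm v (carlitz_term k c t i) <= (v (k t) * Q * G) ^+ (q ^ i).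
Proof.
move=> G0 cG; rewrite vnorm_carlitz_term !exprMn.
rewrite !ler_pM ?mulr_ge0 ?invr_ge0 ?exprn_ge0 ?(abs_ge0 hv) ?vnorm_ge0 //.
exact: abs_factorialV_le.
Qed.

Lemma carlitz_term0 c t : carlitz_term k c t 0 = k t *: c 0.
Proof. by rewrite /carlitz_term carlitz_factorial0 divr1 expn0 expr1. Qed.

Section Sum.
Variables (c : nat -> 'cV[L]_m) (G : R) (t : laurent F).
Hypotheses (G_ge0 : 0 <= G) (cG : card_bounded c G) (t_small : v (k t) * Q * G < 1).

Let small : 0 <= v (k t) * Q * G < 1.
Proof. by rewrite t_small !mulr_ge0 ?ler0n ?(abs_ge0 hv). Qed.

Lemma has_sum_carlitz : has_sum v (carlitz_term k c t) (carlitz_series k v c t).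
Proof.
have [z cz] := has_sum_majorant hv (expr_card_noninc small) (cvg_expr_card small)
  (fun i => carlitz_term_le t i G_ge0 cG) hc.
by rewrite /carlitz_series (vsumE hv cz).
Qed.

Lemma carlitz_tail_le n z : has_sum v (carlitz_term k c t) z ->
  vnorm v (z - \sum_(i < n) carlitz_term k c t i) <= (v (k t) * Q * G) ^+ (q ^ n).
Proof.
apply: (has_sum_tail_le hv (expr_card_noninc small)) => i.
exact: carlitz_term_le.
Qed.

End Sum.

(** This yields a radius of convergence from a growth constant [G]; the summand 1 keeps the
    denominator positive when [G] is 0. *)
Lemma lt_inv_prod_lt1 (G T : R) : 0 <= G -> 0 <= T -> T < (Q * G + 1)^-1 -> T * Q * G < 1.
Proof.
move=> G0 T0; have QG : 0 <= Q * G by rewrite mulr_ge0 ?ler0n.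
rewrite -[ltRHS]mul1r ltr_pdivlMr ?ltr_wpDl // -mulrA => h.
by apply: le_lt_trans h; rewrite ler_wpM2l // lerDl.
Qed.

Lemma carlitz_bounded_radius c (G : R) : 0 <= G -> card_bounded c G ->
  carlitz_pos_radius k v c.
Proof.
move=> G0 cG; exists (Q * G + 1)^-1; first by rewrite invr_gt0 ltr_wpDl ?mulr_ge0 ?ler0n.
move=> t; rewrite -hk => ht; exists (carlitz_series k v c t).
by apply: (has_sum_carlitz G0 cG); rewrite lt_inv_prod_lt1 ?(abs_ge0 hv).
Qed.

(* The lowest nonzero term of the series, of size [t ^ (q ^ l)], would have to be
   cancelled by a tail of size at most [t ^ (q ^ l.+1)], up to constants. *)
Lemma carlitz_sum0_coef c (G r : R) : 0 <= G -> card_bounded c G -> 0 < r ->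
  (forall t, v (k t) < r -> has_sum v (carlitz_term k c t) 0) ->
  forall i, c i = 0.
Proof.
move=> G0 cG r0 sum0; elim/ltn_ind => l IH; apply/(vnorm_eq0 hv)/eqP.
rewrite eq_le vnorm_ge0 andbT leNgt; apply/negP => cl0.
have QG : 0 <= Q * G by rewrite mulr_ge0 ?ler0n.
(* As [q ^ l.+1 >= q ^ l + 1] and [|t| Q G < 1], the tail is at most [|t| ^ (q ^ l) * (K |t|)]. *)
pose K := (Q * G) ^+ (q ^ l).+1.
have K0 : 0 <= K by rewrite exprn_ge0.
have [|t t0] := @exists_small (Num.min r (Num.min (Q * G + 1)^-1 (vnorm v (c l) / (K + 1)))).
  by rewrite !lt_min r0 invr_gt0 divr_gt0 ?ltr_wpDl.
rewrite !lt_min => /and3P[tr tG tK].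
have T0 : 0 < v (k t) by rewrite lt_def abs_eq0 // fmorph_eq0 t0 abs_ge0.
have ts := lt_inv_prod_lt1 G0 (ltW T0) tG.
have := carlitz_tail_le G0 cG ts l.+1 (sum0 t tr).
rewrite big_ord_recr /= big1 => [|i _]; last by rewrite /carlitz_term IH ?scaler0.
rewrite !add0r vnormN // vnorm_carlitz_term -mulrA => h.
suff : vnorm v (c l) <= K * v (k t).
  apply/negP; rewrite -ltNge; move: tK; rewrite ltr_pdivlMr ?ltr_wpDl //.
  by apply: le_lt_trans; rewrite mulrC ler_wpM2l ?(ltW T0) // lerDl.
rewrite -(ler_pM2l (exprn_gt0 (q ^ l) T0)).
apply: le_trans (le_trans h _); first rewrite ler_wpM2l ?exprn_ge0 ?(ltW T0) //.
  by rewrite ler_peMl ?vnorm_ge0 // invf_ge1 ?abs_factorial_gt0 ?abs_factorial_le1.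
have -> : v (k t) ^+ (q ^ l) * (K * v (k t)) = (v (k t) * Q * G) ^+ (q ^ l).+1.
  by rewrite -[v (k t) * Q * G]mulrA exprMn [v (k t) ^+ _.+1]exprSr -mulrA [K * _]mulrC.
rewrite ler_wiXn2l ?(ltW ts) ?mulr_ge0 ?ler0n ?(ltW T0) //.
by rewrite ltn_exp2l ?card_gt1.
Qed.

(** Removing the leading term [t c_0] leaves a tail of size at most [(|t| Q G) ^ q]. Since [q >= 2],
    this is at most [(|t| Q G) ^ 2], which still tends to 0 after division by [t]. *)
Lemma carlitz_initial_condition c (G : R) : 0 <= G -> card_bounded c G ->
  initial_condition k v (carlitz_series k v c) (c 0).
Proof.
move=> G0 cG e e0; have QG : 0 <= Q * G by rewrite mulr_ge0 ?ler0n.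
have K0 : 0 < (Q * G) ^+ 2 + 1 by rewrite ltr_wpDl ?exprn_ge0.
exists (Num.min (Q * G + 1)^-1 (e / ((Q * G) ^+ 2 + 1))).
  by rewrite !lt_min invr_gt0 divr_gt0 ?ltr_wpDl ?exprn_ge0.
move=> t t0; rewrite -hk lt_min => /andP[tG te].
have T0 : 0 < v (k t) by rewrite lt_def abs_eq0 // fmorph_eq0 t0 abs_ge0.
have ts := lt_inv_prod_lt1 G0 (ltW T0) tG.
have := carlitz_tail_le G0 cG ts 1 (has_sum_carlitz G0 cG ts).
rewrite big_ord1 carlitz_term0 => h.
have -> : c 0 = (k t)^-1 *: (k t *: c 0) by rewrite scalerK // fmorph_eq0.
rewrite -scalerBr vnormZ // absV // ltr_pdivrMl //.
apply: (le_lt_trans h); rewrite expn1.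
apply: (@le_lt_trans _ _ ((v (k t) * Q * G) ^+ 2)).
  by rewrite ler_wiXn2l ?(ltW ts) ?mulr_ge0 ?ler0n ?(ltW T0) ?card_gt1.
rewrite -mulrA exprMn expr2 -mulrA ltr_pM2l //.
move: te; rewrite ltr_pdivlMr //; apply: le_lt_trans.
by rewrite ler_wpM2l ?(ltW T0) // lerDl.
Qed.

(** Nonzero points exist arbitrarily close to 0, and at one of them [u t / t] is close to both
    candidates. *)
Lemma initial_condition_unique (u : laurent F -> 'cV[L]_m) (y0 y1 : 'cV[L]_m) :
  initial_condition k v u y0 -> initial_condition k v u y1 -> y0 = y1.
Proof.
move=> h0 h1; apply/eqP; rewrite -subr_eq0; apply/eqP/(vnorm_eq0 hv)/eqP.
rewrite eq_le vnorm_ge0 andbT; apply/ler_addgt0Pl => e e0; rewrite addr0.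
have [r r0 H0] := h0 e e0; have [r' r0' H1] := h1 e e0.
have [|t t0] := @exists_small (Num.min r r'); first by rewrite lt_min r0 r0'.
rewrite lt_min !hk => /andP[tr tr'].
apply: (vnorm_dist_le hv (w := (k t)^-1 *: u t)); last exact: ltW (H1 _ t0 tr').
by rewrite vnormB // ltW // H0.
Qed.

Lemma le_max1_expr (M : R) n : M <= Num.max 1 M ^+ (q ^ n).
Proof.
have M1 : 1 <= Num.max 1 M by rewrite le_max lexx.
apply: (@le_trans _ _ (Num.max 1 M)); first by rewrite le_max lexx orbT.
by rewrite -[leLHS]expr1 ler_weXn2l ?card_expn_gt0.
Qed.

Lemma max1_mul_ge1 (M T : R) : 0 < T -> T < 1 -> 1 <= Num.max 1 M / T.
Proof.
move=> T0 T1; rewrite ler_pdivlMr // mul1r (le_trans (ltW T1)) //.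
by rewrite le_max lexx.
Qed.

(** At a single nonzero [t] in the disc the terms are bounded by some [M]. Since [|1 / D i| >= 1],
    dividing by [|t| ^ (q ^ i)] bounds the coefficients, and [M] is absorbed into the base of the
    power. *)
Lemma carlitz_radius_bounded c : carlitz_pos_radius k v c ->
  exists2 G : R, 1 <= G & card_bounded c G.
Proof.
move=> [r r0 Hr]; have [|t t0] := @exists_small (Num.min r 1); first by rewrite lt_min r0 ltr01.
rewrite lt_min hk => /andP[/Hr[z /(has_sum_bounded hv)[M HM]]]; rewrite -hk => t1.
have T0 : 0 < v (k t) by rewrite lt_def abs_eq0 // fmorph_eq0 t0 abs_ge0.
exists (Num.max 1 M / v (k t)) => [|i]; first exact: max1_mul_ge1.
rewrite exprMn exprVn ler_pdivlMr ?exprn_gt0 // (le_trans _ (le_max1_expr M i)) //.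
apply: le_trans (HM i); rewrite vnorm_carlitz_term [leLHS]mulrC -mulrA.
rewrite ler_wpM2l ?exprn_ge0 ?(ltW T0) // ler_peMl ?vnorm_ge0 //.
by rewrite invf_ge1 ?abs_factorial_gt0 ?abs_factorial_le1.
Qed.

(** Frobenius fixes the basis vectors, so the series at [t e_j] has as terms the [j]-th columns of
    the [pi n] scaled by [t ^ (q ^ n)]. Bounded terms thus bound all columns, and by the ultrametric
    inequality the matrices as operators. *)
Lemma tau_radius_bounded (pi : nat -> 'M[L]_m) : tau_pos_radius F v pi ->
  exists2 A : R, 1 <= A &
    forall n z, vnorm v (pi n *m z) <= A ^+ (q ^ n) * vnorm v z.
Proof.
move=> [r r0 Hr]; have [|t t0] := @exists_small (Num.min r 1); first by rewrite lt_min r0 ltr01.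
rewrite lt_min => /andP[tr t1].
have T0 : 0 < v (k t) by rewrite lt_def abs_eq0 // fmorph_eq0 t0 abs_ge0.
pose e j : 'cV[L]_m := delta_mx j 0.
have tau_e n j : tau_iter F n (e j) = e j.
  apply/colP => i; rewrite !mxE; case: (_ && _) => /=; first by rewrite expr1n.
  by rewrite expr0n gtn_eqF ?card_expn_gt0.
have /choice[M HM] : forall j, exists M : R,
    forall n, vnorm v (tau_term F pi (k t *: e j) n) <= M.
  move=> j; have [|z /(has_sum_bounded hv)//] := Hr (k t *: e j).
  rewrite vnormZ //; apply: le_lt_trans tr; rewrite ler_piMr ?(abs_ge0 hv) //.
  apply: vnorm_le => // i; rewrite mxE; case: (_ && _) => /=; first by rewrite abs1.
  by rewrite abs0.
pose M' := \big[Num.max/0]_j M j.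
exists (Num.max 1 M' / v (k t)) => [|n z]; first exact: max1_mul_ge1.
have zE : z = \sum_j z j 0 *: e j.
  apply/colP => i; rewrite summxE (bigD1 i) //= big1 => [|j ji]; rewrite !mxE ?eqxx ?mulr1 ?addr0 //.
  by rewrite eq_sym (negbTE ji) mulr0.
rewrite {1}zE mulmx_sumr.
apply: vnorm_sum_le => // [|j _].
  by rewrite mulr_ge0 ?vnorm_ge0 ?exprn_ge0 ?divr_ge0 ?(ltW T0) // le_max ler01.
rewrite -scalemxAr vnormZ // mulrC ler_pM ?vnorm_ge0 ?(abs_ge0 hv) //; last exact: abs_le_vnorm.
rewrite exprMn exprVn ler_pdivlMr ?exprn_gt0 // (le_trans _ (le_max1_expr M' n)) //.
apply: le_trans (le_trans (HM j n) _); last exact: le_bigmax.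
by rewrite /tau_term tauZ tau_e -scalemxAr vnormZ // absX // mulrC.
Qed.

(** * The equation in terms of coefficients *)

Section Equation.
Variables (pi : nat -> 'M[L]_m) (phi : nat -> 'cV[L]_m) (A B : R).
Hypotheses (A_ge1 : 1 <= A) (B_ge1 : 1 <= B).
Hypothesis piA : forall n z, vnorm v (pi n *m z) <= A ^+ (q ^ n) * vnorm v z.
Hypothesis phiB : card_bounded phi B.
Hypothesis hroot : forall a : L, exists b, b ^+ q = a.

(* The coefficients of [P(tau) y] on the functions [t ^ (q ^ l) / D l]. *)
Definition tau_coef y l : 'cV[L]_m :=
  \sum_(h < l.+1) k (D l / D (l - h) ^+ (q ^ h)) *: (pi h *m tau_iter F h (y (l - h)%N)).

(* The coefficients of [d y]. *)
Definition d_coef y l : 'cV[L]_m := map_mx (@qroot F L) (y l.+1).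

(** By [hroot] the choice in [qroot] never falls back on its default value. *)
Lemma tau1_qroot z : tau_iter F 1 (map_mx (@qroot F L) z) = z.
Proof. by apply/colP => i; rewrite !mxE expn1; exact: (xgetPex 0 (hroot (z i 0))). Qed.

Lemma tau_d_coef y l : tau_iter F 1 (d_coef y l) = y l.+1.
Proof. exact: tau1_qroot. Qed.

Lemma vnorm_tau_coef_term y l h : (h <= l)%N ->
  vnorm v (k (D l / D (l - h) ^+ (q ^ h)) *: (pi h *m tau_iter F h (y (l - h)%N))) <=
  A ^+ (q ^ h) * vnorm v (y (l - h)%N) ^+ (q ^ h).
Proof.
move=> hl; rewrite vnormZ // -[leRHS]mul1r ler_pM ?(abs_ge0 hv) ?vnorm_ge0 //; last first.
  by rewrite -vnorm_tau.
rewrite rmorphM fmorphV rmorphXn absM // absV // absX // ler_pdivrMr ?exprn_gt0 ?abs_factorial_gt0 //.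
by have := abs_factorialD_le (l - h) h; rewrite subnK // mul1r.
Qed.

(** The term of index [h] is at most [A ^ (q ^ h) * (G ^ (q ^ (l - h))) ^ (q ^ h)], whose second
    factor is [G ^ (q ^ l)]. *)
Lemma tau_coef_bounded y (G : R) : 1 <= G -> card_bounded y G ->
  card_bounded (tau_coef y) (A * G).
Proof.
move=> G1 yG l; have A0 := le_trans ler01 A_ge1; have G0 := le_trans ler01 G1.
apply: vnorm_sum_le => // [|[h /= /[!ltnS] hl] _]; first by rewrite exprn_ge0 ?mulr_ge0.
apply: le_trans (vnorm_tau_coef_term y hl) _.
rewrite exprMn ler_pM ?exprn_ge0 ?vnorm_ge0 //.
  by rewrite ler_weXn2l // leq_pexp2l ?card_gt0.
apply: le_trans (lerXn2r _ _ _ (yG _)) _; rewrite ?nnegrE ?exprn_ge0 ?vnorm_ge0 //.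
by rewrite -exprM -expnD subnK.
Qed.

Lemma d_coef_bounded y (G : R) : 0 <= G -> card_bounded y G -> card_bounded (d_coef y) G.
Proof.
move=> G0 yG l; have := yG l.+1; rewrite -tau_d_coef vnorm_tau expn1 expnSr exprM.
by rewrite ler_pXn2r ?card_gt0 ?nnegrE ?vnorm_ge0 ?exprn_ge0.
Qed.

(** The factor [D l] cancels, and what remains of the scalar is the [q ^ h]-th power of
    [t ^ (q ^ (l - h)) / D (l - h)]. *)
Lemma carlitz_term_tau_coef y t l : carlitz_term k (tau_coef y) t l =
  \sum_(h < l.+1) pi h *m tau_iter F h (carlitz_term k y t (l - h)).
Proof.
rewrite /carlitz_term /tau_coef scaler_sumr; apply: eq_bigr => -[h /= hl] _.
rewrite tauZ -scalemxAr scalerA -rmorphXn -rmorphM; congr (k _ *: _).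
have cancel_mid (K : fieldType) (a b c : K) : b != 0 -> a / b * (b / c) = a / c.
  by move=> b0; rewrite mulrA divfK.
rewrite cancel_mid ?carlitz_factorial_neq0 // [RHS]exprMn exprVn -exprM -expnD subnK //.
Qed.

(** The triangle [h + i < N] is summed along its diagonals on the left and along its rows on the
    right. *)
Lemma sum_tau_coef y t N :
  \sum_(l < N) carlitz_term k (tau_coef y) t l =
  \sum_(h < N) pi h *m tau_iter F h (\sum_(i < N - h) carlitz_term k y t i).
Proof.
elim: N => [|N IH]; first by rewrite !big_ord0.
rewrite big_ord_recr IH carlitz_term_tau_coef !(big_ord_recr N) /= subnn addrA.
rewrite subSnn big_ord1 -big_split /=; congr (_ + _).
apply: eq_bigr => -[h /= hN] _; rewrite subSn ?(ltnW hN) //.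
by rewrite big_ord_recr /= tauD mulmxDr.
Qed.

(** * Both [P(tau) y] and [d y] as Carlitz series *)

Section Solution.
Variables (y : nat -> 'cV[L]_m) (G : R) (t : laurent F).
Hypotheses (G_ge1 : 1 <= G) (yG : card_bounded y G).
Hypothesis t_small : v (k t) * Q * (A * G) < 1.

Local Notation u := (carlitz_series k v y).

Let A_ge0 : 0 <= A. Proof. exact: le_trans ler01 A_ge1. Qed.
Let G_ge0 : 0 <= G. Proof. exact: le_trans ler01 G_ge1. Qed.
Let s_ge0 : 0 <= v (k t) * Q * G. Proof. by rewrite !mulr_ge0 ?(abs_ge0 hv) ?ler0n. Qed.

Let t_smallG : v (k t) * Q * G < 1.
Proof. by apply: le_lt_trans t_small; rewrite mulrCA ler_peMl. Qed.

Lemma has_sum_tau_term : has_sum v (tau_term F pi (u t)) (carlitz_series k v (tau_coef y) t).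
Proof.
have s0 : 0 <= v (k t) * Q * (A * G) by rewrite mulrCA mulr_ge0.
have AG0 : 0 <= A * G by rewrite mulr_ge0.
have Cb := tau_coef_bounded G_ge1 yG.
have s01 : 0 <= v (k t) * Q * (A * G) < 1 by rewrite s0.
apply: (vcvg_squeeze (cvg_expr_card s01)) => N.
apply: (vnorm_dist_le hv (w := \sum_(l < N) carlitz_term k (tau_coef y) t l)); last first.
  rewrite vnormB //; apply: (carlitz_tail_le AG0 Cb t_small).
  exact: (has_sum_carlitz AG0 Cb t_small).
(* After the triangular rearrangement, each of the finitely many rows misses a tail
   of the inner series. *)
rewrite sum_tau_coef -sumrB; apply: vnorm_sum_le => // [|[h /= hN] _].
  by rewrite exprn_ge0.
rewrite /tau_term -mulmxBr -tauB; apply: (le_trans (piA _ _)).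
rewrite vnorm_tau mulrCA [leRHS]exprMn; apply: ler_pM; rewrite ?exprn_ge0 ?vnorm_ge0 //.
  by rewrite ler_weXn2l // leq_pexp2l ?card_gt0 // ltnW.
have := carlitz_tail_le G_ge0 yG t_smallG (N - h) (has_sum_carlitz G_ge0 yG t_smallG).
move=> /(lerXn2r (q ^ h)) H; apply: le_trans (H _ _) _; rewrite ?nnegrE ?vnorm_ge0 ?exprn_ge0 //.
by rewrite -exprM -expnD subnK // ltnW.
Qed.

(** The series of [u (x t) - x u t] has terms [[l] y_l t ^ (q ^ l) / D l], and [[l+1] / D (l+1) = 1
    / D l ^ q] turns them into [q]-th powers of the terms with coefficients [d_coef y]. *)
Lemma has_sum_d_coef : has_sum v (carlitz_term k (d_coef y) t) (carlitz_d k u t).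
Proof.
have X_small : v (k (laurentX F * t)) * Q * G < 1.
  apply: le_lt_trans t_smallG; rewrite rmorphM absM // -!mulrA ler_piMl ?mulr_ge0 ?(abs_ge0 hv) ?ler0n //.
  exact: ltW abs_X_lt1.
have hd := has_sum_carlitz G_ge0 (d_coef_bounded G_ge0 yG) t_smallG.
suff -> : carlitz_d k u t = carlitz_series k v (d_coef y) t by [].
(* Both sides are compared after applying the injective Frobenius, which removes the [q]-th
   roots. *)
apply: (@tau_inj 1); rewrite tau1_qroot.
have h1 := has_sumB hv (has_sum_carlitz G_ge0 yG X_small)
  (has_sumZ hv (k X) (has_sum_carlitz G_ge0 yG t_smallG)).
apply: (has_sum_unique hv) (has_sum_tau 1 hd).
(* The term of index 0 is [x t y_0 - x t y_0 = 0], so the series may start at index 1. *)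
apply: eq_has_sum (has_sum_shift _ h1) => [l|]; last first.
  by rewrite !carlitz_term0 rmorphM scalerA subrr.
rewrite /= /carlitz_term scalerA -scalerBl tauZ tau_d_coef -rmorphM -rmorphB -rmorphXn.
congr (k _ *: _).
have b0 : carlitz_bracket F l.+1 != 0.
  have := carlitz_factorial_neq0 l.+1; rewrite carlitz_factorialS.
  by rewrite mulf_eq0 negb_or => /andP[].
have cancel_bracket (K : fieldType) (x x' a b d : K) : b = x' - x -> b != 0 ->
    x' * a / (b * d) - x * (a / (b * d)) = a / d.
  move=> -> bK; rewrite mulrA -mulrBl -mulrBl invfM mulrACA divff //.
  by rewrite mul1r.
rewrite [in LHS]exprMn carlitz_factorialS (cancel_bracket _ _ _ _ _ _ (erefl _) b0).
by rewrite [RHS]exprMn exprVn -exprM expn1 -expnSr.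
Qed.

End Solution.

(** * Equivalence of the local equation with the recurrence *)

Lemma formal_equation_local_solution y (G : R) : 1 <= G -> card_bounded y G ->
  (forall l, d_coef y l = tau_coef y l + phi l) ->
  local_solution k v pi phi (carlitz_series k v y).
Proof.
move=> G1 yG yE; have G0 := le_trans ler01 G1.
have A0 := le_trans ler01 A_ge1; have B0 := le_trans ler01 B_ge1.
exists (Num.min (Q * (A * G) + 1)^-1 (Q * B + 1)^-1) => [|t].
  by rewrite lt_min !invr_gt0 !ltr_wpDl ?mulr_ge0 ?ler0n.
rewrite lt_min -hk => /andP[tA tB].
have tA1 := lt_inv_prod_lt1 (mulr_ge0 A0 G0) (abs_ge0 hv _) tA.
have tB1 := lt_inv_prod_lt1 B0 (abs_ge0 hv _) tB.
have hP := has_sum_tau_term G1 yG tA1.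
have hf := has_sum_carlitz B0 phiB tB1.
split; [by eexists; exact: hP|by eexists; exact: hf|].
rewrite /tau_series (vsumE hv hP).
apply: (has_sum_unique hv (has_sum_d_coef G1 yG tA1)).
have hC := has_sum_carlitz (mulr_ge0 A0 G0) (tau_coef_bounded G1 yG) tA1.
apply: eq_has_sum (has_sumD hv hC hf) => l.
by rewrite /carlitz_term yE scalerDr.
Qed.

(** The difference of the two coefficient sequences gives a Carlitz series with sum 0 at all small
    [t], hence vanishes. *)
Lemma local_solution_formal_equation y (G : R) : 1 <= G -> card_bounded y G ->
  local_solution k v pi phi (carlitz_series k v y) ->
  forall l, d_coef y l = tau_coef y l + phi l.
Proof.
move=> G1 yG [r r0 Hr] l; have G0 := le_trans ler01 G1.
have A0 := le_trans ler01 A_ge1; have B0 := le_trans ler01 B_ge1.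
(* A common growth constant for [d_coef y], [tau_coef y] and [phi]. *)
pose E := Num.max (A * G) B.
have E0 : 0 <= E by rewrite le_max B0 orbT.
have leE (c : nat -> 'cV[L]_m) (H : R) : 0 <= H -> H <= E -> card_bounded c H -> card_bounded c E.
  by move=> H0 HE cH i; rewrite (le_trans (cH i)) // lerXn2r ?nnegrE.
have AG : A * G <= E by rewrite le_max lexx.
have dE : card_bounded (d_coef y) E.
  apply: leE (d_coef_bounded G0 yG) => //; apply: le_trans AG.
  by rewrite ler_peMl.
have tE : card_bounded (tau_coef y) E.
  by apply: leE (tau_coef_bounded G1 yG) => //; rewrite mulr_ge0.
have fE : card_bounded phi E by apply: leE phiB => //; rewrite le_max lexx orbT.
pose c i := d_coef y i - (tau_coef y i + phi i).
have cE : card_bounded c E.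
  by move=> i; rewrite vnormB_le // vnormD_le.
apply/eqP; rewrite -subr_eq0; apply/eqP; move: l.
pose r' := Num.min r (Q * E + 1)^-1.
apply: (@carlitz_sum0_coef c E r') => // [|t].
  by rewrite lt_min r0 invr_gt0 ltr_wpDl ?mulr_ge0 ?ler0n.
rewrite lt_min => /andP[tr tE1].
have ts := lt_inv_prod_lt1 E0 (abs_ge0 hv _) tE1.
have tA1 : v (k t) * Q * (A * G) < 1.
  by apply: le_lt_trans ts; rewrite ler_wpM2l ?mulr_ge0 ?(abs_ge0 hv) ?ler0n.
have hP := has_sum_tau_term G1 yG tA1.
have hf := has_sum_carlitz E0 fE ts.
have hC := has_sum_carlitz E0 tE ts.
have hd := has_sum_d_coef G1 yG tA1.
move: tr; rewrite hk => /Hr[_ _]; rewrite /tau_series (vsumE hv hP) => eqn.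
have := has_sumB hv hd (has_sumD hv hC hf); rewrite eqn subrr.
apply: eq_has_sum => i.
by rewrite /carlitz_term /c scalerBr scalerDr.
Qed.

(** * Solving the recurrence and bounding its solution *)

Section Existence.
Variable y0 : 'cV[L]_m.

(** Course-of-values recursion: [tau_coef] takes a whole sequence, so each stage is a sequence whose
    entries are final up to index [n] and arbitrary beyond. *)
Fixpoint approx n : nat -> 'cV[L]_m :=
  if n is n'.+1 then fun i =>
    if (i <= n')%N then approx n' i
    else tau_iter F 1 (tau_coef (approx n') n' + phi n')
  else fun=> y0.

Definition solution_coef n := approx n n.

Lemma approxE n i : (i <= n)%N -> approx n i = solution_coef i.
Proof.
elim: n => [|n IH]; first by rewrite leqn0 => /eqP ->.
by rewrite leq_eqVlt => /predU1P[-> //|]; rewrite ltnS /= => i_n; rewrite i_n IH.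
Qed.

Lemma solution_coefS l :
  solution_coef l.+1 = tau_iter F 1 (tau_coef solution_coef l + phi l).
Proof.
rewrite /solution_coef /= ltnn; congr (tau_iter _ _ (_ + _)).
by apply: eq_bigr => h _; rewrite approxE ?leq_subr.
Qed.

Lemma d_solution_coef l : d_coef solution_coef l = tau_coef solution_coef l + phi l.
Proof. by apply: (@tau_inj 1); rewrite tau_d_coef solution_coefS. Qed.

Lemma solution_coef_bounded : exists2 G : R, 1 <= G & card_bounded solution_coef G.
Proof.
pose E := Num.max (Num.max A B) (vnorm v y0).
have AE : A <= E by rewrite !le_max lexx.
have BE : B <= E by rewrite !le_max lexx orbT.
have yE : vnorm v y0 <= E by rewrite !le_max lexx orbT.
have E1 : 1 <= E := le_trans A_ge1 AE.
have E0 : 0 <= E := le_trans ler01 E1.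
have A0 := le_trans ler01 A_ge1; have B0 := le_trans ler01 B_ge1.
(* With [e l = 3 q ^ l - 2], the recurrence needs [q ^ h.+1 * (1 + e (l - h)) <= e l.+1],
   which the offset [2] provides. *)
suff H l : vnorm v (solution_coef l) <= E ^+ (3 * q ^ l - 2).
  exists (E ^+ 3) => [|l]; first by rewrite exprn_ege1.
  by rewrite (le_trans (H l)) // -exprM ler_weXn2l // leq_subr.
elim/ltn_ind: l => -[|l] IH; first by rewrite expn0 expr1.
have ql i : (0 < q ^ i)%N := card_expn_gt0 i.
rewrite solution_coefS vnorm_tau expn1.
(* Since [q >= 2], the exponent [q * (3 q ^ l - 1) = 3 q ^ l.+1 - q] is at most [3 q ^ l.+1 - 2]. *)
apply: (@le_trans _ _ ((E ^+ (3 * q ^ l - 1)) ^+ q)); last first.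
  rewrite -exprM ler_weXn2l // mulnBl mul1n -mulnA -expnSr leq_sub2l //.
  exact: card_gt1.
rewrite lerXn2r ?nnegrE ?vnorm_ge0 ?exprn_ge0 // vnormD_le //; last first.
  rewrite (le_trans (phiB l)) // (le_trans (y := E ^+ (q ^ l))) ?lerXn2r ?nnegrE //.
  by rewrite ler_weXn2l //; move: (q ^ l)%N (ql l); clear; lia.
apply: vnorm_sum_le => // [|[h /= /[!ltnS] hl] _]; first by rewrite exprn_ge0.
apply: le_trans (vnorm_tau_coef_term _ hl) _.
apply: (@le_trans _ _ (E ^+ (q ^ h) * (E ^+ (3 * q ^ (l - h) - 2)) ^+ (q ^ h))).
  rewrite ler_pM ?exprn_ge0 ?vnorm_ge0 ?lerXn2r ?nnegrE ?exprn_ge0 ?vnorm_ge0 //.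
  by rewrite IH // ltnS leq_subr.
rewrite -exprM -exprD ler_weXn2l // mulnBl -mulnA -expnD subnK //.
(* The exponent is [q ^ h + (3 q ^ l - 2 q ^ h) = 3 q ^ l - q ^ h]; this inequality makes the
   truncated subtraction exact. *)
have : (q ^ h <= q ^ l)%N by rewrite leq_pexp2l ?card_gt0.
move: (ql h); move: (q ^ h)%N (q ^ l)%N; clear; move=> a b. lia.
Qed.

Lemma formal_equation_unique y : y 0 = y0 ->
  (forall l, d_coef y l = tau_coef y l + phi l) -> y = solution_coef.
Proof.
move=> yy0 yE; apply/funext; elim/ltn_ind => -[//|l] IH.
rewrite -tau_d_coef yE solution_coefS; congr (tau_iter _ _ (_ + _)).
by apply: eq_bigr => h _; rewrite IH // ltnS leq_subr.
Qed.

End Existence.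
End Equation.

End Vector.
End CarlitzFactorial.

(** * Roots in the completed algebraic closure *)

Section CompletedClosure.
Variables (R : realType) (F : finFieldType) (Kbar C : fieldType).
Variables (j : {rmorphism laurent F -> Kbar}) (i : {rmorphism Kbar -> C}) (v : C -> R).
Hypothesis ccC : is_completed_closure j i v.

(** Elements of [Kbar] approximating [z] have [n]-th roots there. Additivity of the power gives
    [|b - b'| ^ n = |b ^ n - b' ^ n|], so these roots form a Cauchy sequence, and its limit is a
    root of [z]. *)
Lemma completed_closure_root (n : nat) (z : C) : (0 < n)%N ->
  (forall a b : C, (a - b) ^+ n = a ^+ n - b ^+ n) -> exists w, w ^+ n = z.
Proof.
move=> n0 powB; have [[closedK _] hv _ dense complete] := ccC.
have /choice[b Hb] : forall h : nat, exists b : Kbar, v (z - i b ^+ n) < h.+1%:R^-1.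
  move=> h; have [|a Ha] := dense z h.+1%:R^-1; first by rewrite invr_gt0.
  (* The closed field axiom solves [X ^ n = P(X)] with [P] of degree below [n]; here [P] is the
     constant [a]. *)
  have [b bn] := closedK n (fun l => if l == 0%N then a else 0) n0.
  exists b; rewrite -rmorphXn bn; case: n n0 powB bn => // n _ _ _.
  by rewrite big_ord_recl big1 ?expr0 ?mulr1 ?addr0 // => l _; rewrite mul0r.
have small (e : R) : 0 < e -> exists N, forall h, (N <= h)%N -> v (z - i (b h) ^+ n) < e.
  move=> e0; have /cvgrPdist_lt/(_ e e0)[N _ HN] := @cvg_harmonic R.
  exists N => h /HN /=; rewrite sub0r normrN ger0_norm ?invr_ge0 //.
  exact: lt_trans.
have [e e0|w Hw] := complete (fun h => i (b h)).
  have [N HN] := small (e ^+ n) (exprn_gt0 _ e0).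
  exists N => h h' /HN Hh /HN Hh'.
  rewrite -(ltr_pXn2r n0) ?nnegrE ?(abs_ge0 hv) ?(ltW e0) //.
  have -> : v (i (b h) - i (b h')) ^+ n = v ((z - i (b h') ^+ n) - (z - i (b h) ^+ n)).
    by rewrite -absX // powB; congr v; rewrite opprB [RHS]addrC addrA subrK.
  by apply: le_lt_trans (absB_max hv _ _) _; rewrite gt_max Hh Hh'.
exists w; apply/eqP; rewrite -subr_eq0 -(abs_eq0 hv) eq_le (abs_ge0 hv) andbT.
apply/ler_addgt0Pl => e e0; rewrite addr0.
have [N HN] := small e e0.
have /cvgrPdist_lt/(_ (Num.min e 1))[|N' _ HN'] := Hw; first by rewrite lt_min e0 ltr01.
have := HN' _ (leq_maxr N N'); have := HN _ (leq_maxl N N').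
rewrite /= sub0r normrN ger0_norm ?(abs_ge0 hv) //; set a := i _ => za.
rewrite lt_min => /andP[aw aw1].
have -> : w ^+ n - z = (a ^+ n - z) - (a - w) ^+ n.
  by rewrite powB opprB [RHS]addrC addrA subrK.
apply: le_trans (absB_max hv _ _) _; rewrite ge_max absB // (ltW za) /= absX //.
apply: le_trans (ltW aw); rewrite -[leRHS]expr1 ler_wiXn2l ?(abs_ge0 hv) //.
exact: ltW.
Qed.

End CompletedClosure.

(** * Frobenius and [q]-th roots in [C], then existence and uniqueness *)

Theorem theorem1 (R : realType) (p upsilon : nat) (p_prime : prime p)
    (upsilon_gt0 : (0 < upsilon)%N) (F : finFieldType)
    (cardF : #|F| = (p ^ upsilon)%N)
    (Kbar C : fieldType) (j : {rmorphism laurent F -> Kbar})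
    (i : {rmorphism Kbar -> C}) (v : C -> R)
    (ccC : is_completed_closure j i v)
    (m : nat) (m_gt0 : (0 < m)%N)
    (pi : nat -> 'M[C]_m) (phi : nat -> 'cV[C]_m)
    (pi_radius : @tau_pos_radius R F C v m pi)
    (phi_radius : carlitz_pos_radius (i \o j) v phi)
    (y0 : 'cV[C]_m) :
  exists! y : nat -> 'cV[C]_m,
    [/\ carlitz_pos_radius (i \o j) v y,
        local_solution (i \o j) v pi phi (carlitz_series (i \o j) v y) &
        initial_condition (i \o j) v (carlitz_series (i \o j) v y) y0].
Proof.
have hv := cc_abs ccC; have hc := cc_complete ccC.
have hk t : v ((i \o j) t) = laurent_abs R t by exact: (cc_extends ccC).
(* The characteristic passes from [F] to Laurent series and along the embedding to [C]; as [#|F|] is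
   a power of [p], this makes the [q ^ n]-th power additive. *)
have pC : p \in [pchar C].
  have pL := pchar_laurent (card_finPcharP cardF p_prime).
  apply/andP; split=> //; move/andP: pL => [_ /eqP pL].
  by rewrite -(rmorph_nat (i \o j)) pL rmorph0.
have frob n (a b : C) : (a + b) ^+ (#|F| ^ n) = a ^+ (#|F| ^ n) + b ^+ (#|F| ^ n).
  by apply: exprDn_pchar; rewrite (eq_pnat _ (pcharf_eq pC)) cardF -expnM pnatX pnat_id.
have hroot (a : C) : exists b, b ^+ #|F| = a.
  apply: (completed_closure_root ccC _ (card_gt0 F)) => a' b.
  by apply/eqP; rewrite eq_sym subr_eq; have := frob 1%N (a' - b) b; rewrite expn1 subrK => <-.
have [A A1 piA] := tau_radius_bounded hv hk pi_radius.
have [B B1 phiB] := carlitz_radius_bounded hv hk phi_radius.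
pose y := solution_coef (i \o j) pi phi y0.
have [G G1 yG] := solution_coef_bounded hv hk A1 B1 piA phiB y0.
have G0 := le_trans ler01 G1.
exists y; split=> [|y' [/(carlitz_radius_bounded hv hk)[G' G'1 yG'] sol init]].
  split.
  - exact: (carlitz_bounded_radius hv hk hc G0 yG).
  - apply: (formal_equation_local_solution hv hk frob hc A1 B1 piA phiB hroot G1 yG).
    exact: (d_solution_coef _ hv frob _ _ hroot).
  - exact: (carlitz_initial_condition hv hk hc G0 yG).
(* The series of [y'] also meets the initial condition with value [y' 0], so uniqueness of that
   value gives [y' 0 = y0]. *)
apply/esym/(formal_equation_unique hroot).
  have G'0 := le_trans ler01 G'1.
  exact: initial_condition_unique (carlitz_initial_condition hv hk hc G'0 yG') init.
exact: (local_solution_formal_equation hv hk frob hc A1 B1 piA phiB hroot G'1 yG' sol).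
Qed.
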